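(* Let $d\in\{1,2\}$ and consider a random point process on $\mathbb R^d$, defined on a probability space $\Omega$, for which $\lim_{N\to\infty}\mathbb E(\mathcal W_N)$ exists and is finite and $\lim_{N\to\infty}\mathrm{Var}(\mathcal W_N)=0$. Then $$\mathcal W_N\to\lim_{M\to\infty}\mathbb E\,\mathcal W_M\quad\text{as }N\to\infty$$ in $L^2(\Omega)$, and thus in probability.
   Context: For a random locally finite configuration $\{a_i\}$ the random variable $\mathcal W_N$ ($N\ge1$) is defined as follows. For $d=1$, $$\mathcal W_N=-\frac1N\sum_{i\ne j,\ a_i,a_j\in[0,N]}\log\left|2\sin\frac{\pi(a_i-a_j)}{N}\right|+\log N .$$ For $d=2$ (with $\mathbb R^2\cong\mathbb C$), $$\mathcal W_N=\frac1{2\pi N^2}\sum_{i\neq j,\ a_i,a_j\in[0,N]^2}E_N(a_i-a_j)+\log\frac{N}{2\pi\eta(i)^2},$$ where $E_N(x)=\sum_{(m,n)\in\mathbb Z^2\setminus\{0\}}e^{2i\pi(m\,\mathrm{Re}(x)/N+n\,\mathrm{Im}(x)/N)}\frac1{m^2+n^2}$ (as the Fourier series of an $(N\mathbb Z)^2$-periodic function), $\eta(\tau)=q^{1/24}\prod_{k\ge1}(1-q^k)$ with $q=e^{2i\pi\tau}$ is the Dedekind eta function, and in $\eta(i)$ the symbol $i$ is the imaginary unit. *)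

(* Defs.v *)
From HB Require Import structures.
From mathcomp Require Import all_boot all_order all_algebra.
From mathcomp Require Import complex.
From mathcomp Require Import all_classical all_reals all_analysis.
From mathcomp Require Import measurable_realfun.

Set Implicit Arguments.
Unset Strict Implicit.
Unset Printing Implicit Defensive.
Import Order.TTheory GRing.Theory Num.Theory.
Import numFieldNormedType.Exports.

Local Open Scope classical_set_scope.
Local Open Scope ring_scope.
Local Open Scope complex_scope.

(* Points of R^d are d-tuples, with the product Borel sigma-algebra.  A
   configuration may have repeated points: it is encoded by its multiplicity
   function. *)
Record configuration (R : realType) (d : nat) := Configuration {
  mult :> d.-tuple R -> nat ;
  _ : forall r : R, finite_set
        [set x | (0 < mult x)%N /\ forall k : 'I_d, `|tnth x k| <= r] }.

Definition num_points (R : realType) (d : nat) (c : configuration R d)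
    (B : set (d.-tuple R)) : \bar R :=
  (\esum_(x in B) ((c x)%:R : R)%:E)%E.

Record point_process (R : realType) (d : nat) (dO : measure_display)
    (Omega : measurableType dO) := PointProcess {
  config :> Omega -> configuration R d ;
  _ : forall B : set (d.-tuple R), measurable B ->
        measurable_fun setT (fun w => num_points (config w) B) }.

(* A point x of multiplicity k carries the k labels (x, 0), ..., (x, k - 1),
   so that the labels play the role of the indices i of the family {a_i},
   with a_i the first component of i. *)
Definition labels (R : realType) (d : nat) (c : configuration R d)
    (B : set (d.-tuple R)) : set (d.-tuple R * nat) :=
  [set i | B i.1 /\ (i.2 < c i.1)%N].

Definition pair_sum (R : realType) (d : nat) (c : configuration R d)
    (B : set (d.-tuple R)) (g : d.-tuple R -> d.-tuple R -> \bar R) : \bar R :=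
  (\sum_(p \in [set p | [/\ labels c B p.1, labels c B p.2 & p.1 <> p.2]])
     g p.1.1 p.2.1)%E.

Definition box (R : realType) (d N : nat) : set (d.-tuple R) :=
  [set x | forall k : 'I_d, 0 <= tnth x k <= N%:R].

Definition cexp (R : realType) (z : R[i]) : R[i] :=
  (expR (complex.Re z))%:C * (cos (complex.Im z) +i* sin (complex.Im z)).

(* The Fourier series of E_N does not converge absolutely; it is summed over
   the squares |m|, |n| <= M.  The partial sums are real, since the terms of
   indices (m, n) and (-m, -n) are conjugate.  The limit is taken in the
   extended reals: it is finite off (N Z)^2, and +oo on (N Z)^2. *)
Definition fourier_partial (R : realType) (N M : nat) (x : R[i]) : R[i] :=
  \sum_(k \in [set k : int * int |
           [/\ `|k.1| <= M%:Z, `|k.2| <= M%:Z & k <> (0, 0)]])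
    cexp ('i * (2 * pi * (k.1%:~R * complex.Re x / N%:R +
                          k.2%:~R * complex.Im x / N%:R))%:C)
    * ((k.1%:~R ^+ 2 + k.2%:~R ^+ 2)^-1)%:C.

Definition E_ (R : realType) (N : nat) (x : R[i]) : \bar R :=
  limn (fun M => (complex.Re (fourier_partial N M x))%:E).

Definition dedekind_eta (R : realType) (tau : R[i]) : R[i] :=
  let q := cexp (2 * pi%:C * 'i * tau) in
  cexp (2 * pi%:C * 'i * tau / 24)
  * limn ((fun n => \prod_(1 <= k < n.+1) (1 - q ^+ k)) : nat -> R[i]^o).

Definition to_complex (R : realType) (x : 2.-tuple R) : R[i] :=
  tnth x 0 +i* tnth x 1.

(* The values are extended reals: if two points of [0, N]^d coincide modulo
   N Z^d then log 0 = -oo (for d = 1) or E_N(0) = +oo (for d = 2) enters the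
   sum, and W_N = +oo. *)
Definition W1 (R : realType) (N : nat) (c : configuration R 1) : \bar R :=
  ((- (N%:R)^-1)%:E * pair_sum c (box N)
      (fun x y => lne (`|2 * sin (pi * (tnth x 0 - tnth y 0) / N%:R)|)%:E)
   + (ln N%:R)%:E)%E.

(* eta(i) is a positive real. *)
Definition W2 (R : realType) (N : nat) (c : configuration R 2) : \bar R :=
  (((2 * pi * N%:R ^+ 2)^-1)%:E * pair_sum c (box N)
      (fun x y => E_ N (to_complex x - to_complex y)%R)
   + (ln (N%:R / (2 * pi * complex.Re (dedekind_eta ('i : R[i]) ^+ 2))))%:E)%E.

Definition W (R : realType) (d N : nat) : configuration R d -> \bar R :=
  match d with
  | 1 => @W1 R N
  | 2 => @W2 R N
  | _ => fun=> 0%E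
  end.

(* The library's 'E_P and 'V_P are restricted to real-valued functions. *)
Definition mean (dO : measure_display) (Omega : measurableType dO)
    (R : realType) (P : probability Omega R) (X : Omega -> \bar R) : \bar R :=
  (\int[P]_w X w)%E.

Definition var (dO : measure_display) (Omega : measurableType dO)
    (R : realType) (P : probability Omega R) (X : Omega -> \bar R) : \bar R :=
  mean P (fun w => (X w - mean P X) ^+ 2)%E.

Definition cvg_L2 (dO : measure_display) (Omega : measurableType dO)
    (R : realType) (P : probability Omega R) (X : nat -> Omega -> \bar R)
    (l : R) : Prop :=
  (forall N, measurable_fun setT (X N)) /\
  (fun N => 'N[P]_2%:E[(fun w => X N w - l%:E)]%E) @ \oo --> 0%E.

Definition cvg_in_probability (dO : measure_display)
    (Omega : measurableType dO) (R : realType) (P : probability Omega R)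
    (X : nat -> Omega -> \bar R) (l : R) : Prop :=
  forall e : R, 0 < e ->
    (fun N => P [set w | (e%:E <= `|X N w - l%:E|)%E]) @ \oo --> 0%E.

(* Main.v *)
Require Import Defs.
From mathcomp Require Import all_boot all_order all_algebra.
From mathcomp Require Import complex finmap lra.
From mathcomp Require Import all_classical all_reals all_analysis.
From mathcomp Require Import measurable_realfun.
Import Order.TTheory GRing.Theory Num.Theory.
Import numFieldNormedType.Exports.

(* With m = E W_N, the pointwise bound (W_N - l)^2 <= 2 (W_N - m)^2 + 2 (m - l)^2
   integrates to E (W_N - l)^2 <= 2 Var W_N + 2 (E W_N - l)^2, which tends to 0;
   Markov's inequality then gives convergence in probability.

   The substantial part is that W_N is measurable, knowing only that the
   counting variables xi(B) are.  The number of pairs of distinct labels with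
   positions in A x B is xi(A) xi(B) - xi(A n B) (all sets being cut down to the
   box), so the pair counting measure is measurable on rectangles, hence on all
   measurable sets by Dynkin's theorem, and its integrals against measurable
   kernels are measurable. *)

Set Implicit Arguments.
Unset Strict Implicit.

Local Open Scope classical_set_scope.
Local Open Scope ring_scope.
Local Open Scope ereal_scope.

(** * Measurability of pointwise limits *)

(* [limn] is the constant [point] on the set where the sequence diverges. *)
Lemma measurable_fun_limn d (T : measurableType d) (R : realType)
    (f : (T -> \bar R)^nat) :
  (forall n, measurable_fun setT (f n)) ->
  measurable_fun setT (fun x => limn (f ^~ x)).
Proof.
move=> mf.
(* In the extended reals a sequence converges exactly when its upper and lower limits agree, and
   both are measurable in [x]. *)
have cvgE x : cvgn (f ^~ x) <-> limn_esup (f ^~ x) = limn_einf (f ^~ x).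
  split=> [cf|ei]; first by rewrite is_cvg_limn_einfE// is_cvg_limn_esupE.
  apply/cvg_ex; exists (limn_esup (f ^~ x)).
  apply: (@squeeze_cvge _ _ _ _ (einfs (f ^~ x)) _ (esups (f ^~ x))).
  - apply: nearW => n; apply/andP; split.
      by apply: ereal_inf_lbound; exists n => /=.
    by apply: ereal_sup_ubound; exists n => /=.
  - by rewrite ei limn_einf_lim; exact: is_cvg_einfs.
  - by rewrite limn_esup_lim; exact: is_cvg_esups.
rewrite (_ : (fun _ => _) = fun x =>
    if limn_esup (f ^~ x) == limn_einf (f ^~ x)
    then limn_esup (f ^~ x) else point); last first.
  apply/funext => x; case: eqP => [/cvgE cf|ncf].
    by rewrite is_cvg_limn_esupE.
  by apply: dvgP => /cvgE.
have mesup : measurable_fun setT (fun x => limn_esup (f ^~ x)).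
  exact: measurable_fun_limn_esup.
apply: measurable_fun_ifT => //.
apply: measurable_fun_eqe => //.
by apply: measurableT_comp => //; apply: measurable_fun_limn_esup => n;
  exact: measurableT_comp.
Qed.

(** * Sums over a random finite family *)

Section finite_random_sum.
Context d d' (X : measurableType d) (Y : measurableType d') (R : realType).
(** Only the counts of entries in measurable sets are controlled; the order of the entries of [s x]
    may depend on [x] arbitrarily. *)
Variable s : X -> seq Y.
Hypothesis ms : forall U, measurable U ->
  measurable_fun setT (fun x => \sum_(y <- s x) \d_y U : \bar R).

(** The sum is the integral of [f] against the sum of the Dirac masses at the entries of [s x], a
    measure that depends measurably on [x] by [ms]. *)
Lemma measurable_fun_ge0_sum_seq (f : Y -> \bar R) :
  (forall y, 0 <= f y) -> measurable_fun setT f ->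
  measurable_fun setT (fun x => \sum_(y <- s x) f y).
Proof.
move=> f0 mf.
pose l x := msum (fun i => dirac (nth point (s x) i) : {measure set Y -> \bar R})
  (size (s x)).
have lE x U : l x U = \sum_(y <- s x) \d_y U by rewrite (big_nth point) big_mkord.
rewrite (_ : (fun x => _) = (fun x => \int[l x]_y f y)).
  apply: measurable_fun_integral_kernel => // U mU.
  rewrite (_ : (fun x => _) = (fun x => \sum_(y <- s x) \d_y U)); first exact: ms.
  by apply/funext => x; exact: lE.
apply/funext => x; rewrite ge0_integral_measure_sum// (big_nth point) big_mkord.
by apply: eq_bigr => i _; rewrite integral_dirac// diracT mul1e.
Qed.

(** Addition of extended reals stays associative and commutative when [+oo] meets [-oo], so positive
    and negative parts can be summed separately for any [f]. *)
Lemma measurable_fun_sum_seq (f : Y -> \bar R) : measurable_fun setT f ->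
  measurable_fun setT (fun x => \sum_(y <- s x) f y).
Proof.
move=> mf.
rewrite (_ : (fun x => _) = (fun x => \sum_(y <- s x) f^\+ y - \sum_(y <- s x) f^\- y)).
  apply: emeasurable_funB; apply: measurable_fun_ge0_sum_seq => //.
    exact: measurable_funepos.
  exact: measurable_funeneg.
apply/funext => x; rewrite -sumeN.
  by rewrite -big_split/=; apply: eq_bigr => y _; exact: (congr1 (@^~ y) (funeposneg f)).
move=> y z _ _; apply: ge0_adde_def; rewrite inE; exact: funeneg_ge0.
Qed.

End finite_random_sum.

(** Rectangles are stable under intersection and generate the product sigma-algebra, so Dynkin's
    theorem applies. *)
Lemma measurable_sum_dirac_prod d d1 d2 (X : measurableType d)
    (Y : measurableType d1) (Z : measurableType d2) (R : realType)
    (s : X -> seq (Y * Z)) :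
  (forall A B, measurable A -> measurable B ->
    measurable_fun setT (fun x => \sum_(y <- s x) \d_y (A `*` B) : \bar R)) ->
  forall U, measurable U ->
    measurable_fun setT (fun x => \sum_(y <- s x) \d_y U : \bar R).
Proof.
move=> ms U; rewrite measurable_prod_measurableType; move: U.
apply: dynkin_induction.
- exact: measurable_prod_measurableType.
- move=> _ _ [A1 mA1 [B1 mB1 <-]] [A2 mA2 [B2 mB2 <-]].
  rewrite -setXI; exists (A1 `&` A2); first exact: measurableI.
  by exists (B1 `&` B2) => //; exact: measurableI.
- by rewrite -setXTT; exact: ms.
- by move=> _ [A mA [B mB <-]]; exact: ms.
- move=> S mS mSs.
  (* Dirac masses are finite, so the count of the complement is the total count minus the count of
     [S]. *)
  rewrite (_ : (fun x => _) = (fun x => \sum_(y <- s x) \d_y (setT `*` setT)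
      - \sum_(y <- s x) \d_y S)); first by apply: emeasurable_funB => //; exact: ms.
  apply/funext => x; rewrite -fin_num_sumeN; last first.
    by move=> y _; rewrite diracE.
  rewrite -big_split/=; apply: eq_bigr => y _.
  rewrite setXTT diracT /dirac !indicE in_setC; case: (y \in S) => /=.
    exact: (congr1 (@EFin R) (esym (subrr (1%R : R)))).
  exact: (congr1 (@EFin R) (esym (subr0 (1%R : R)))).
- move=> F mF tF msF.
  rewrite (_ : (fun x => _) =
      (fun x => \sum_(0 <= n <oo) \sum_(y <- s x) \d_y (F n))).
    apply: ge0_emeasurable_sum => //.
    by move=> k x _ _; apply: sume_ge0.
  apply/funext => x; rewrite nneseries_sum//; apply: eq_bigr => y _.
  by rewrite measure_semi_bigcup//; exact: bigcup_measurable.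
Qed.

(* Counting labels and pairs of labels in the box *)
Local Close Scope ereal_scope.

Lemma finite_labels_box (R : realType) (d N : nat) (c : configuration R d) :
  finite_set (labels c (box N)).
Proof.
have cfin : finite_set [set x | (0 < c x)%N /\ forall k : 'I_d, `|tnth x k| <= N%:R].
  by case: c => c; exact.
have := @finite_setXR _ _ _ (fun x => `I_(c x)) cfin (fun x _ => finite_II (c x)).
apply: sub_finite_set => -[x k] [/= boxx kx]; split=> //=; split.
  exact: leq_ltn_trans kx.
by move=> i; have /andP[x0 xN] := boxx i; rewrite ger0_norm.
Qed.

(** Above a position [x] lie exactly [c x] labels, so summing position by position recovers the
    counting variable, the quantity that a point process makes measurable. *)
Lemma sum_indic_labels (R : realType) (d N : nat) (c : configuration R d)
    (A : set (d.-tuple R)) :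
  (\sum_(i \in labels c (box N)) (\1_A i.1 : R))%:E = num_points c (A `&` box N).
Proof.
rewrite /num_points esum_mkcondl -fsumEFin; last exact: finite_labels_box.
rewrite -esum_fset; [|exact: finite_labels_box|by move=> i _; rewrite lee_fin].
rewrite (_ : labels _ _ = box N `*`` (fun x => `I_(c x)))//.
rewrite -(@esum_esum _ _ _ _ _ (fun x _ => (\1_A x : R)%:E)); last first.
  by move=> x k _ _; rewrite lee_fin.
apply: eq_esum => x _; rewrite esum_fset//.
rewrite fsumEFin// -fsbig_ord sumr_const card_ord indicE.
by case: (x \in A); rewrite //= mul0rn.
Qed.

(** This is the index set of [pair_sum] over the box; distinct labels may share a position, so the
    copies of a multiple point also form pairs. *)
Definition distinct_labels (R : realType) (d N : nat) (c : configuration R d) :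
    set ((d.-tuple R * nat) * (d.-tuple R * nat)) :=
  [set p | [/\ labels c (box N) p.1, labels c (box N) p.2 & p.1 <> p.2]].

Lemma finite_distinct_labels (R : realType) (d N : nat) (c : configuration R d) :
  finite_set (distinct_labels N c).
Proof.
have lfin := finite_labels_box N c.
apply: (sub_finite_set _ (finite_setX lfin lfin)).
by move=> p [].
Qed.

(** The product of the two sums runs over all ordered pairs of labels; its diagonal terms add up to
    the count of the intersection of [A] and [B]. *)
Lemma sum_distinct_labels (R : realType) (d N : nat) (c : configuration R d)
    (A B : set (d.-tuple R)) :
  \sum_(p \in distinct_labels N c) (\1_(A `*` B) (p.1.1, p.2.1) : R) =
  (\sum_(i \in labels c (box N)) (\1_A i.1 : R)) *
  (\sum_(i \in labels c (box N)) (\1_B i.1 : R)) -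
  \sum_(i \in labels c (box N)) (\1_(A `&` B) i.1 : R).
Proof.
have lfin := finite_labels_box N c.
set L := labels c (box N) in lfin *.
apply/esym/eqP; rewrite subr_eq; apply/eqP.
rewrite mulr_fsuml.
under eq_fsbigr do rewrite mulr_fsumr.
rewrite pair_fsbig//=.
rewrite (fsbigID [set p | p.1 <> p.2])/=; last exact: finite_setX.
congr (_ + _).
  rewrite (_ : _ `&` _ = distinct_labels N c); last first.
    by apply/seteqP; split => [p [[? ?] ?]|p [? ? ?]].
  by apply: eq_fsbigr => p _; rewrite !indicE in_setX/=;
    case: (_ \in A); case: (_ \in B); rewrite /= ?(mulr1,mulr0).
rewrite (_ : _ `&` _ = (fun i => (i, i)) @` L); last first.
  apply/seteqP; split => [[i j] /= [[Li Lj] /contrapT/= ij]|_ [i Li <-]].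
    by exists i => //; rewrite ij.
  by split => //=; exact.
rewrite fsbig_image/=; last by move=> i j _ _ [].
by apply: eq_fsbigr => i _; rewrite !indicE in_setI/=;
    case: (_ \in A); case: (_ \in B); rewrite /= ?(mulr1,mulr0).
Qed.

Lemma measurable_box (R : realType) (d N : nat) : measurable (@box R d N).
Proof.
rewrite (_ : box N = \bigcap_(k in [set: 'I_d]) (@tnth d R ^~ k) @^-1` `[0, N%:R]).
  apply: fin_bigcap_measurable => // k _; rewrite -[X in measurable X]setTI.
  exact: measurable_tnth.
by apply/seteqP; split=> x xN k => [_|]; have /= := xN k; rewrite /= in_itv/=; auto.
Qed.

Lemma measurable_pair_sum (R : realType) (d N : nat) (dO : measure_display)
    (Omega : measurableType dO) (a : point_process R d Omega)
    (g : d.-tuple R -> d.-tuple R -> \bar R) :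
  measurable_fun setT (fun z : d.-tuple R * d.-tuple R => g z.1 z.2) ->
  measurable_fun setT (fun w => pair_sum (a w) (box N) g).
Proof.
move=> mg.
have ma U : measurable U -> measurable_fun setT (fun w => num_points (a w) U).
  by case: (a) => f mf; exact: mf.
(* [s w] lists the pairs of positions with multiplicity, so [pair_sum] is the sum of the kernel
   along it. *)
pose s w : seq (d.-tuple R * d.-tuple R) :=
  [seq (p.1.1, p.2.1) | p <- fset_set (distinct_labels N (a w))].
rewrite (_ : (fun w => _) = fun w => (\sum_(z <- s w) g z.1 z.2)%E); last first.
  by apply/funext => w; rewrite big_map -fsbig_finite//; exact: finite_distinct_labels.
apply: (@measurable_fun_sum_seq _ _ _ _ _ _ _ (fun z => g z.1 z.2)) => //.
apply: measurable_sum_dirac_prod => A B mA mB.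
have mlab U : measurable U ->
    measurable_fun setT (fun w => \sum_(i \in labels (a w) (box N)) (\1_U i.1 : R)).
  move=> mU; apply/measurable_EFinP.
  rewrite (_ : _ \o _ = fun w => num_points (a w) (U `&` box N)); last first.
    by apply/funext => w; exact: sum_indic_labels.
  by apply: ma; apply: measurableI => //; exact: measurable_box.
(* All counts are finite, so the pair count is a real polynomial in three measurable counts. *)
rewrite (_ : (fun w => _) = EFin \o (fun w =>
  (\sum_(i \in labels (a w) (box N)) (\1_A i.1 : R)) *
  (\sum_(i \in labels (a w) (box N)) (\1_B i.1 : R)) -
  \sum_(i \in labels (a w) (box N)) (\1_(A `&` B) i.1 : R))).
  apply/measurable_EFinP; apply: measurable_funB; last exact/mlab/measurableI.
  by apply: measurable_funM; exact: mlab.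
apply/funext => w; rewrite big_map -fsbig_finite/=; last exact: finite_distinct_labels.
by rewrite fsumEFin ?sum_distinct_labels//; exact: finite_distinct_labels.
Qed.

(** * Measurability of the kernels and of [W N] *)

Local Open Scope complex_scope.

Lemma measurable_lne_EFin (R : realType) :
  measurable_fun setT (fun r : R => lne r%:E).
Proof.
rewrite /lne; apply: measurable_fun_ifT => //.
  exact: measurable_fun_ler.
by apply/measurable_EFinP; exact: measurable_ln.
Qed.

Lemma Re_cexp_iM (R : realType) (t r : R) :
  complex.Re (cexp ('i * t%:C) * r%:C) = cos t * r.
Proof.
rewrite /cexp /=.
by rewrite !(mul0r, mul1r, mulr0, mulr1, subr0, sub0r, addr0, add0r, expR0, oppr0).
Qed.

Lemma Re_sum (R : realType) (I : Type) (s : seq I) (F : I -> R[i]) :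
  complex.Re (\sum_(k <- s) F k) = \sum_(k <- s) complex.Re (F k).
Proof. exact: raddf_sum. Qed.

Lemma finite_fourier_index (M : nat) : finite_set [set k : int * int |
  [/\ `|k.1| <= M%:Z, `|k.2| <= M%:Z & k <> (0, 0)]].
Proof.
have fZ : finite_set [set m : int | `|m| <= M%:Z].
  apply: (@sub_finite_set _ _
      ((fun n => n%:Z) @` `I_M.+1 `|` (fun n => - n%:Z) @` `I_M.+1)).
    (* The constructor of negative integers sends [n] to [-(n + 1)], whence the witness [n.+1]. *)
    move=> [n|n] /= nM; [left; exists n => //|right; exists n.+1 => //].
  by rewrite finite_setU; split; exact: finite_image.
apply: (sub_finite_set _ (finite_setX fZ fZ)) => k [? ? _]; exact.
Qed.

(** The real part is a finite sum of cosines of linear forms in the real and imaginary parts of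
    [f t], with constant weights. *)
Lemma measurable_Re_fourier_partial (R : realType) (N M : nat) d
    (T : measurableType d) (f : T -> R[i]) :
  measurable_fun setT (fun t => complex.Re (f t)) ->
  measurable_fun setT (fun t => complex.Im (f t)) ->
  measurable_fun setT (fun t => complex.Re (fourier_partial N M (f t))).
Proof.
move=> mRe mIm; rewrite /fourier_partial.
under eq_fun do rewrite (fsbig_finite _ _ (finite_fourier_index M)) Re_sum.
apply: measurable_sum => k.
under eq_fun do rewrite Re_cexp_iM.
apply: measurable_funM => //; apply: measurableT_comp => //.
  by apply: continuous_measurable_fun; exact: continuous_cos.
apply: measurable_funM => //; apply: measurable_funD;
  by apply: measurable_funM => //; exact: measurable_funM.
Qed.

Lemma measurable_tnth_sub (R : realType) (n : nat) (i : 'I_n) :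
  measurable_fun setT
    (fun z : n.-tuple R * n.-tuple R => tnth z.1 i - tnth z.2 i).
Proof.
by apply: measurable_funB; apply: (@measurableT_comp _ _ _ _ _ _ (@tnth n R ^~ i));
  [exact: measurable_tnth|exact: measurable_fst
  |exact: measurable_tnth|exact: measurable_snd].
Qed.

Lemma measurable_W1 (R : realType) (N : nat) (dO : measure_display)
    (Omega : measurableType dO) (a : point_process R 1 Omega) :
  measurable_fun setT (fun w => W1 N (a w)).
Proof.
apply: emeasurable_funD => //; apply: emeasurable_funM => //.
apply: measurable_pair_sum.
apply: (@measurableT_comp _ _ _ _ _ _ (fun r : R => lne r%:E)).
  exact: measurable_lne_EFin.
apply: measurableT_comp => //; apply: measurable_funM => //.
apply: measurableT_comp.
  by apply: continuous_measurable_fun; exact: continuous_sin.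
apply: measurable_funM => //; apply: measurable_funM => //.
exact: measurable_tnth_sub.
Qed.

Lemma measurable_W2 (R : realType) (N : nat) (dO : measure_display)
    (Omega : measurableType dO) (a : point_process R 2 Omega) :
  measurable_fun setT (fun w => W2 N (a w)).
Proof.
apply: emeasurable_funD => //; apply: emeasurable_funM => //.
(* The kernel [E_ N] is a pointwise [limn] of measurable partial sums, hence measurable whether or
   not they converge at every point. *)
apply: measurable_pair_sum; apply: measurable_fun_limn => M.
apply/measurable_EFinP; apply: measurable_Re_fourier_partial => /=;
  exact: measurable_tnth_sub.
Qed.

(* Second moments and the two modes of convergence *)
Local Close Scope complex_scope.
Local Open Scope ereal_scope.

(* At infinite [x] both sides are [+oo]. *)
Lemma sqre_sub_le (R : realType) (x : \bar R) (m l : R) :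
  (x - l%:E) ^+ 2 <= 2%:E * (x - m%:E) ^+ 2 + (2 * (m - l) ^+ 2)%R%:E.
Proof.
case: x => [x| |]; last 2 first.
- by rewrite /= ?(addye,addNye)// mulyy gt0_muley// addye// leey.
- by rewrite /= ?(addye,addNye)// mulNyNy gt0_muley// addye// leey.
rewrite -!EFinB -!EFin_expe -EFinM -EFinD lee_fin.
(* With [a = x - m] and [b = m - l], the difference of the two sides is
   [2 a^2 + 2 b^2 - (a + b)^2 = (a - b)^2]. *)
by have := sqr_ge0 (x - m - (m - l)); nra.
Qed.

(** Turns the integrand of the L^2 norm, a real power, into the algebraic square. *)
Lemma poweR_abse2 (R : realType) (x : \bar R) : `|x| `^ 2 = x ^+ 2.
Proof.
case: x => [x| |].
- by rewrite -EFin_expe /= powR_mulrn// real_normK// num_real.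
- by rewrite /= mulyy ifF//; apply/negbTE; rewrite pnatr_eq0.
- by rewrite /= mulNyNy ifF//; apply/negbTE; rewrite pnatr_eq0.
Qed.

(** Identifies the deviation event at level [e] with the event that Markov's inequality bounds for
    the square at level [e ^+ 2]. *)
Lemma lee_abse_sqre (R : realType) (e : R) (x : \bar R) : (0 < e)%R ->
  ((e ^+ 2)%:E <= `|x ^+ 2|) = (e%:E <= `|x|).
Proof.
move=> e0; rewrite gee0_abs ?sqre_ge0//; case: x => [x| |].
- by rewrite -EFin_expe /= !lee_fin -[in LHS](real_normK (num_real x)) ler_sqr// nnegrE ltW.
- by rewrite /= mulyy !leey.
- by rewrite /= mulNyNy !leey.
Qed.

Section second_moment.
Context d (T : measurableType d) (R : realType) (P : probability T R).

Lemma measurable_sqre_sub (X : T -> \bar R) (l : R) :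
  measurable_fun setT X -> measurable_fun setT (fun w => (X w - l%:E) ^+ 2).
Proof.
move=> mX.
have mXl : measurable_fun setT (fun w => X w - l%:E) by exact: emeasurable_funB.
exact: (emeasurable_funM mXl mXl).
Qed.

Lemma second_moment_le (X : T -> \bar R) (l : R) : measurable_fun setT X ->
  mean P X \is a fin_num ->
  \int[P]_w (X w - l%:E) ^+ 2 <=
  2%:E * var P X + (2 * (fine (mean P X) - l) ^+ 2)%R%:E.
Proof.
move=> mX mfin; rewrite /var -(fineK mfin); set m := fine (mean P X).
rewrite {1}/mean -ge0_integralZl//; last 2 first.
  exact: measurable_sqre_sub.
  by move=> w _; exact: sqre_ge0.
(* The constant term becomes an integral because [P] has total mass one. *)
rewrite -[X in _ + X]mule1 -(@probability_setT _ _ _ P) -integral_cst//.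
rewrite -ge0_integralD//.
- apply: ge0_le_integral => //.
  + by move=> w _; exact: sqre_ge0.
  + exact: measurable_sqre_sub.
  + apply: emeasurable_funD => //; apply: emeasurable_funM => //.
    exact: measurable_sqre_sub.
  + by move=> w _; exact: sqre_sub_le.
- by move=> w _; rewrite mule_ge0// sqre_ge0.
- by apply: emeasurable_funM => //; exact: measurable_sqre_sub.
- by move=> w _; rewrite lee_fin mulr_ge0// sqr_ge0.
Qed.

Variables (X : nat -> T -> \bar R) (l : R).
Hypothesis mX : forall N, measurable_fun setT (X N).

(** Means converging to the real [l] are finite for large [N], so the bound of [second_moment_le]
    holds eventually, and both of its terms tend to 0. *)
Lemma second_moment_cvg0 :
  (fun N => mean P (X N)) @ \oo --> l%:E ->
  (fun N => var P (X N)) @ \oo --> 0 ->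
  (fun N => \int[P]_w (X N w - l%:E) ^+ 2) @ \oo --> 0.
Proof.
move=> /fine_cvgP[mfin ml] v0.
apply: (@squeeze_cvge _ _ _ _ (cst 0) _
  (fun N => 2%:E * var P (X N) + (2 * (fine (mean P (X N)) - l) ^+ 2)%R%:E)).
- near=> N; apply/andP; split; first by apply: integral_ge0 => w _; exact: sqre_ge0.
  apply: second_moment_le => //.
  by near: N.
- exact: cvg_cst.
- rewrite -[X in _ --> X]adde0; apply: cvgeD => //.
    by rewrite -[X in _ --> X](mule0 2%:E); apply: cvgeZl.
  apply: cvg_EFin; first by near=> N.
  have -> : 0%R = (2 * (l - l) ^+ 2)%R :> R by rewrite subrr expr0n/= mulr0.
  apply: cvgMr; rewrite expr2; apply: cvgM; exact: cvgB ml (cvg_cst _).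
Unshelve. all: by end_near. Qed.

(** The L^2 norm is the square root of the second moment, and the square root is continuous at 0.
    Finitely many second moments may be infinite, so the two are compared for large [N] only. *)
Lemma second_moment_cvg_L2 :
  (fun N => \int[P]_w (X N w - l%:E) ^+ 2) @ \oo --> 0 -> cvg_L2 P X l.
Proof.
move=> /fine_cvgP[Ifin I0]; split=> //.
have I0' : Num.sqrt (fine (\int[P]_w (X N w - l%:E) ^+ 2)) @[N --> \oo] --> Num.sqrt (0 : R)%R.
  exact: (cvg_comp _ _ I0 (@sqrt_continuous R 0%R)).
rewrite sqrtr0 in I0'.
have : (Num.sqrt (fine (\int[P]_w (X N w - l%:E) ^+ 2)))%:E @[N --> \oo] --> 0.
  by apply/fine_cvgP; split; [exact: nearW|exact: I0'].
apply: cvg_trans; apply: near_eq_cvg; near=> N.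
rewrite unlock /Lnorm.
under eq_integral do rewrite poweR_abse2.
rewrite poweR12_sqrt ?integral_ge0//; last by move=> w _; exact: sqre_ge0.
have /fineK <- : \int[P]_w (X N w - l%:E) ^+ 2 \is a fin_num by near: N.
by [].
Unshelve. all: by end_near. Qed.

Lemma second_moment_cvg_in_probability :
  (fun N => \int[P]_w (X N w - l%:E) ^+ 2) @ \oo --> 0 ->
  cvg_in_probability P X l.
Proof.
move=> I0 e e0.
apply: (@squeeze_cvge _ _ _ _ (cst 0) _
  (fun N => (e ^- 2)%R%:E * \int[P]_w (X N w - l%:E) ^+ 2)).
- apply: nearW => N; rewrite measure_ge0/=.
  rewrite lee_pdivlMl ?exprn_gt0//.
  (* Markov's inequality for the squared deviation at level [e ^+ 2]. *)
  have := @le_integral_abse _ _ _ P setT measurableT (fun w => (X N w - l%:E) ^+ 2) (e ^+ 2)%R.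
  rewrite setTI => /(_ (measurable_sqre_sub _ (mX N)) (exprn_gt0 2 e0)).
  under eq_integral do rewrite gee0_abs ?sqre_ge0//.
  by under eq_set do rewrite lee_abse_sqre//.
- exact: cvg_cst.
- by rewrite -[X in _ --> X](mule0 (e ^- 2)%R%:E); apply: cvgeZl.
Qed.

End second_moment.

Local Close Scope ereal_scope.
Unset Implicit Arguments.

Theorem corollary5p2 (R : realType) (d : nat) (hd : d = 1%N \/ d = 2%N)
    (dO : measure_display) (Omega : measurableType dO)
    (P : probability Omega R) (a : point_process R d Omega) (l : R)
    (hmean : (fun N => mean P (fun w => W N (a w))) @ \oo --> l%:E)
    (hvar : (fun N => var P (fun w => W N (a w))) @ \oo --> 0%E) :
  cvg_L2 P (fun N w => W N (a w)) l /\
  cvg_in_probability P (fun N w => W N (a w)) l.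
Proof.
have mW N : measurable_fun setT (fun w => W N (a w)).
  (* The dimension enters only here; the rest uses just measurability and the first two moments. *)
  by case: hd a {hmean hvar} => -> a; [exact: measurable_W1|exact: measurable_W2].
have I0 := second_moment_cvg0 mW hmean hvar.
by split; [exact: second_moment_cvg_L2|exact: second_moment_cvg_in_probability].
Qed.
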